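(* Let $M$ be a rank $3$ simple matroid, let $\Gamma_M$ be its Levi graph and $D_M$ its matroid divisor, and let $d$ be the degree of $D_M$. Then for any lift of $\Gamma_M$ to a metrized complex with rational components, there also exists a lift of $D_M$ to a limit $g^2_d$ on that metrized complex.
   Context: A rank $3$ simple matroid $M$ consists of a finite set $E$ of elements and a collection $F$ of subsets of $E$, called flats, such that any pair of (distinct) elements is contained in exactly one flat, and such that there are at least two flats; here ''flat'' always means rank $2$ flat, so flats have at least two elements. The graph $\Gamma_M$ is the bipartite graph with vertex set $E\amalg F$ and an edge between $e\in E$ and $f\in F$ when $e\in f$. The matroid divisor $D_M$ is the sum of all vertices of $\Gamma_M$ corresponding to elements of $E$. Metrized complexes (Amini--Baker). Let $k$ be an algebraically closed field. A lift of $\Gamma_M$ to a metrized complex $\mathfrak C$ with rational components consists of $\Gamma_M$, regarded as a metric graph $\Gamma$ with all edges of length $1$ and vertex set $V=E\amalg F$, together with a curve $C_v\cong\mathbb P^1_k$ for each vertex $v$, and distinct points $x_v^{\epsilon}\in C_v(k)$ for the edges $\epsilon$ incident to $v$. Points of $\mathfrak C$ are points of $\Gamma\setminus V$ and $k$-points of the curves $C_v$ (the endpoint at $v$ of the edge $\epsilon$ is identified with $x_v^{\epsilon}$). A divisor on $\mathfrak C$ is a finite formal integer combination of points of $\mathfrak C$. A (nonzero) rational function $h$ on $\mathfrak C$ consists of a continuous piecewise affine function $h_\Gamma$ on $\Gamma$ with integer slopes and a nonzero rational function $h_v$ on $C_v$ for each vertex $v$. Its divisor is $\operatorname{div}(h)=\sum_x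 \operatorname{ord}_x(h)\,x$, where: for $x\in\Gamma\setminus V$, $\operatorname{ord}_x(h)$ is minus the sum of the outgoing slopes of $h_\Gamma$ at $x$; for $x\in C_v(k)$ not one of the points $x_v^\epsilon$, $\operatorname{ord}_x(h)=\operatorname{ord}_x(h_v)$; and for $x=x_v^\epsilon$, $\operatorname{ord}_x(h)=\operatorname{ord}_x(h_v)-s$ where $s$ is the outgoing slope of $h_\Gamma$ at $v$ along $\epsilon$. Given $k$-subspaces $H_v\subset k(C_v)$ for each $v$, the refined (restricted) rank of a divisor $\mathcal D$ on $\mathfrak C$ with respect to $\{H_v\}$ is the largest integer $r$ such that for every effective divisor $\mathcal E$ of degree $r$ on $\mathfrak C$ there is a rational function $h$ with $h_v\in H_v$ for all $v$ and $\mathcal D-\mathcal E+\operatorname{div}(h)\ge 0$. A limit $g^r_d$ on $\mathfrak C$ is given by a degree $d$ divisor $\mathcal D$ supported on the curves $C_v$ together with subspaces $H_v\subset k(C_v)$ of dimension $r+1$ for every $v$, such that the refined rank of $\mathcal D$ with respect to $\{H_v\}$ equals $r$. A lift of the divisor $D_M$ to $\mathfrak C$ is a divisor $\sum_{e\in E} x_e$ with a choice of one point $x_e\in C_e(k)$ for each element $e$; a lift of $D_M$ to a limit $g^2_d$ is a limit $g^2_d$ whose underlying divisor is such a lift. *)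

(* Defs.v *)
From HB Require Import structures.
From mathcomp Require Import all_boot all_order all_algebra.
From mathcomp Require Import boolp classical_sets reals topology normedtype.
From mathcomp.multinomials Require Import freeg.

Set Implicit Arguments.
Unset Strict Implicit.
Unset Printing Implicit Defensive.

Import Order.TTheory GRing.Theory Num.Theory numFieldNormedType.Exports.

Local Open Scope ring_scope.
Local Open Scope classical_set_scope.

Record matroid := Matroid {
  ground :> finType;
  flats : {set {set ground}};
  flat_card : forall f, f \in flats -> (2 <= #|f|)%N;
  flat_pair : forall a b : ground, a != b ->
    exists! f : {set ground}, [/\ f \in flats, a \in f & b \in f];
  flats_card : (2 <= #|flats|)%N
}.

(* The edge [eps] is identified with [0, 1]; [endpt eps false] is the end at  *)
(* 0 and [endpt eps true] is the end at 1.                                    *)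
Record graph := Graph {
  vertex : finType;
  edge : finType;
  endpt : edge -> bool -> vertex
}.

Section Levi.
Variable M : matroid.

Definition flat : finType := {f : {set M} | f \in flats M}.
Definition incidence : finType := {p : M * flat | p.1 \in val p.2}.

Definition levi : graph := {|
  vertex := (M + flat)%type;
  edge := incidence;
  endpt := fun eps b => if b then inr (val eps).2 else inl (val eps).1
|}.

Definition matroid_divisor : {freeg (vertex levi) / int} :=
  \sum_(e : M) << (inl e : vertex levi) >>.

End Levi.

Section ProjectiveLine.
Variable k : closedFieldType.

(* The k-points of P^1; [None] is the point at infinity. *)
Definition P1 : choiceType := option k.

Definition ratfun : fieldType := {fraction {poly k}}.

(* For h = p / q, the order of h at infinity is deg q - deg p, which is also  *)
(* size q - size p; the value for h = 0 is irrelevant.  Any fraction p / q    *)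
(* representing h gives the same result, see [ordP1_div] below.               *)
Definition ordP1 (x : P1) (h : ratfun) : int :=
  let p := \n_(repr h) in let q := \d_(repr h) in
  if x is Some a then (mup a p)%:Z - (mup a q)%:Z
  else (size q)%:Z - (size p)%:Z.

Lemma ordP1_div (p q : {poly k}) (x : P1) : p != 0 -> q != 0 ->
  ordP1 x (tofrac p / tofrac q) =
  if x is Some a then (mup a p)%:Z - (mup a q)%:Z
  else (size q)%:Z - (size p)%:Z.
Proof.
move=> p0 q0; set h := tofrac p / tofrac q.
have d0 : \d_(repr h) != 0 := denom_ratioP (repr h).
have hF : h = tofrac \n_(repr h) / tofrac \d_(repr h).
  rewrite -[LHS]reprK -{1}[repr h]FracField.Ratio_numden.
  have inj (r : {poly k}) : tofrac r = (\pi_(FracField.type _) (Ratio r 1))%qT.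
    by rewrite /tofrac; unlock.
  rewrite !inj /GRing.inv /GRing.mul /= -!FracField.pi_inv -!FracField.pi_mul.
  apply: (congr1 (\pi_(FracField.type _))%qT); rewrite /FracField.invf /FracField.mulf.
  by rewrite !numden_Ratio ?oner_neq0 ?mul1r ?mulr1.
have E : p * \d_(repr h) = \n_(repr h) * q.
  apply/eqP; rewrite -tofrac_eq !tofracM.
  by rewrite -eqr_div ?tofrac_eq0 // -/h -hF.
have n0 : \n_(repr h) != 0.
  by have := mulf_neq0 p0 d0; rewrite E mulf_eq0 negb_or => /andP[].
rewrite /ordP1; case: x => [a|].
  have /(congr1 Posz) : mup a (p * \d_(repr h)) = mup a (\n_(repr h) * q).
    by rewrite E.
  rewrite !mupM // !PoszD => ee.
  by apply/eqP; rewrite subr_eq addrAC eq_sym subr_eq ee.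
have := congr1 (fun r : {poly k} => size r) E.
rewrite !size_mul // => ee.
have /(congr1 Posz) : (size p + size \d_(repr h) = size \n_(repr h) + size q)%N.
  have: (0 < size p + size \d_(repr h))%N by rewrite addn_gt0 size_poly_gt0 p0.
  have: (0 < size \n_(repr h) + size q)%N by rewrite addn_gt0 size_poly_gt0 n0.
  by move: ee; case: (_ + _)%N => // u; case: (_ + _)%N => //= v -> .
rewrite !PoszD => e2.
by apply/eqP; rewrite subr_eq addrAC eq_sym subr_eq [eqbRHS]addrC e2 addrC.
Qed.

Definition lincomb (n : nat) (b : 'I_n -> ratfun) (c : 'I_n -> k) : ratfun :=
  \sum_(i < n) tofrac (c i)%:P * b i.

(* H is a k-linear subspace of dimension n, i.e. it has a basis of size n.    *)
Definition subspace_dim (H : set ratfun) (n : nat) : Prop :=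
  exists b : 'I_n -> ratfun,
    (forall c, lincomb b c = 0 -> forall i, c i = 0) /\
    H = range (lincomb b).

End ProjectiveLine.

Section Slope.
Variable R : realType.

(* The slope at 0, along [0, +oo[, of a function that is affine with integer  *)
(* slope on some [0, r] with r > 0; the slope is unique, see [slopeP].        *)
Definition slope (g : R -> R) : int :=
  xget 0 [set s : int | \forall u \near 0^'+, g u = g 0 + s%:~R * u].

Lemma slopeP (g : R -> R) (s : int) :
  (\forall u \near 0^'+, g u = g 0 + s%:~R * u) -> slope g = s.
Proof.
move=> gs; apply: xget_unique => //= s' gs'.
have : \forall u \near (0 : R)^'+, s' = s.
  near=> u.
  have u0 : u != 0 by rewrite gt_eqF //; near: u; exact: nbhs_right_gt.
  have : g u = g 0 + s%:~R * u by near: u.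
  have -> : g u = g 0 + s'%:~R * u by near: u.
  by move=> /addrI /(mulIf u0) /intr_inj.
by move=> /filter_ex[].
Unshelve. all: by end_near. Qed.

(* On [0, 1].  The pieces are closed intervals, so continuity is implied.     *)
Definition piecewise_affine (g : R -> R) : Prop :=
  exists (n : nat) (t : nat -> R),
    [/\ t 0%N = 0, t n = 1 &
      forall i, (i < n)%N -> t i < t i.+1 /\
        exists s : int, forall u, t i <= u <= t i.+1 ->
          g u = g (t i) + s%:~R * (u - t i)].

End Slope.

Section MetrizedComplex.
Variables (R : realType) (k : closedFieldType) (G : graph).

Definition edge_interior : choiceType :=
  (edge G * {u : R | 0 < u < 1})%type.

(* The metric graph in which every edge of G has length 1. *)
Definition metric_graph : choiceType := (vertex G + edge_interior)%type.

(* The parametrization of an edge by [0, 1]. *)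
Definition edge_point (eps : edge G) (u : R) : metric_graph :=
  if insub u is Some w then inr (eps, w) else inl (endpt eps (1 <= u)).

(* The curve attached to every vertex is P^1 itself; [mark eps b] is the      *)
(* point x_v^eps for v = [endpt eps b].                                       *)
Record metrized_complex := MetrizedComplex {
  mark : edge G -> bool -> P1 k;
  mark_inj : forall (eps eps' : edge G) (b b' : bool),
    endpt eps b = endpt eps' b' -> mark eps b = mark eps' b' ->
    (eps, b) = (eps', b')
}.

(* Points of the metrized complex: [inr (v, p)] is the point p of C_v. *)
Definition point : choiceType := (edge_interior + vertex G * P1 k)%type.

Definition divisor := {freeg point / int}.

Record ratfun_mc := RatfunMc {
  metric_part : metric_graph -> R;
  curve_part : vertex G -> ratfun k;
  metric_part_pa : forall eps : edge G,
    piecewise_affine (fun u => metric_part (edge_point eps u));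
  curve_part_neq0 : forall v, curve_part v != 0
}.

(* The outgoing slope at the end b of the edge eps. *)
Definition end_slope (h : ratfun_mc) (eps : edge G) (b : bool) : int :=
  slope (fun u => metric_part h (edge_point eps (if b then 1 - u else u))).

Variable C : metrized_complex.

(* The coefficients of div(h).  In the second case the sum has at most one    *)
(* term, by [mark_inj], and it has one exactly when p is some x_v^eps.        *)
Definition ord (h : ratfun_mc) (x : point) : int :=
  match x with
  | inl (eps, t) =>
      - (slope (fun u => metric_part h (edge_point eps (val t + u))) +
         slope (fun u => metric_part h (edge_point eps (val t - u))))
  | inr (v, p) =>
      ordP1 p (curve_part h v) -
      \sum_(eps : edge G)
        \sum_(b : bool | (endpt eps b == v) && (mark C eps b == p))
          end_slope h eps b
  end.

(* div(h) has finite support, but D - E + div(h) >= 0 only involves its       *)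
(* coefficients.                                                              *)
Definition refined_rank_ge (D : divisor) (H : vertex G -> set (ratfun k))
    (r : int) : Prop :=
  forall E : divisor, fgle 0 E -> deg E = r ->
    exists h : ratfun_mc,
      (forall v, H v (curve_part h v)) /\
      (forall x, 0 <= coeff x (D - E) + ord h x).

Definition refined_rank (D : divisor) (H : vertex G -> set (ratfun k))
    (r : int) : Prop :=
  refined_rank_ge D H r /\ forall r', refined_rank_ge D H r' -> r' <= r.

Definition limit_grd (r : nat) (d : int) (D : divisor)
    (H : vertex G -> set (ratfun k)) : Prop :=
  [/\ deg D = d,
      forall y : edge_interior, coeff (inl y : point) D = 0,
      forall v, subspace_dim (H v) r.+1 &
      refined_rank D H r].

End MetrizedComplex.

Definition lifts_matroid_divisor (R : realType) (k : closedFieldType)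
    (M : matroid) (D : divisor R k (levi M)) : Prop :=
  exists x : M -> P1 k,
    D = \sum_(e : M) << (inr (inl e, x e) : point R k (levi M)) >>.

(* Main.v *)
From mathcomp Require Import all_boot all_order all_algebra.
From mathcomp Require Import boolp classical_sets reals topology normedtype.
From mathcomp Require Import zify ring lra.
From mathcomp.multinomials Require Import freeg.
Require Import Defs.

(** The lift of the matroid divisor puts the chip of every element [e] at the
    point at infinity of [C_e], and every [H_v] is the full space [L(y1 + y2)]
    of rational functions with poles at most at two chosen points of [C_v].
    Since [P^1] has genus zero, a nonzero [h_v] in such a space may be given by
    prescribing its two zeros [z1] and [z2] freely: its divisor is then
    [z1 + z2 - y1 - y2].  For a flat, [y1] and [y2] are two marked points; for
    an element they are infinity and one marked point.

    The rank is at most 2, as a nonzero element of [L(y1 + y2)] cannot vanish to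
    order 3 at a general point of [C_v] ([refined_rank_le2]).

    For the rank to be at least 2, the metric part of [h] is chosen among
    functions that are determined on each edge by the heights of its ends and by
    two points, the chips of the edge: identifying the edge with [0, 1], the
    part of [div(h)] on the edge is (chips) - (0) - (1).  The divisor
    [D + div(h)] is then a sum of explicit points.  At a vertex [v] it is
    effective, and contains prescribed points of [C_v], as soon as the free
    zeros [z1] and [z2] can fill the marked points that no chip has reached.
    There are two ways to do so: if nearly all edges at [v] have a chip at [v],
    one keeps the zeros that cancel the marked poles ([served_idle]); if nearly
    all edges have both chips at [v], the chips cancel these poles and both
    zeros are free ([served_saturated]).

    It remains to find, for any two points of the metric graph, a metric
    function that brings a chip to both.  Functions centred at one element, the
    hub, suffice: raising the hub by [c <= 2] makes all other elements send their
    chips towards it, and raising moreover one flat on the hub (or several pairwise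
    disjoint flats, with [c = 0]) moves the chips on the edges of that flat
    ([firing]).  That two elements lie on exactly one common flat ensures that
    no element has to send two chips.  The number of points that such a function
    can reach at a given place is its [capacity], and [carries_two_points] is a
    case analysis on the position of the two points. *)

Set Implicit Arguments.
Unset Strict Implicit.
Unset Printing Implicit Defensive.

Import Order.TTheory GRing.Theory Num.Theory numFieldNormedType.Exports.

Local Open Scope ring_scope.
Local Open Scope classical_set_scope.

(** * Rational functions on the projective line *)

Section ProjectiveLine.
Variable k : closedFieldType.
Implicit Types s t y : seq (P1 k).

Definition finite_part s : seq k := pmap id s.

(** Points at infinity contribute no factor: they are seen by the degree, as
    [s] stands for a binary form of degree [size s]. *)
Definition vanishing_poly s : {poly k} := \prod_(a <- finite_part s) ('X - a%:P).

Lemma vanishing_poly_neq0 s : vanishing_poly s != 0.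
Proof. by rewrite monic_neq0 // monic_prod_XsubC. Qed.

Lemma tofrac_vanishing_poly_neq0 s : tofrac (vanishing_poly s) != 0 :> ratfun k.
Proof. by rewrite tofrac_eq0 vanishing_poly_neq0. Qed.

Lemma mup_vanishing_poly a s : mup a (vanishing_poly s) = count_mem (Some a : P1 k) s.
Proof.
rewrite /vanishing_poly mu_prod_XsubC /finite_part.
by elim: s => [|[b|] s IHs] //=; rewrite IHs.
Qed.

Lemma size_vanishing_poly s : (size (vanishing_poly s) + count_mem (None : P1 k) s = (size s).+1)%N.
Proof.
rewrite /vanishing_poly size_prod_XsubC /finite_part addSn; congr _.+1.
by elim: s => [|[b|] s IHs] //=; rewrite ?add0n ?addSn ?addnS IHs.
Qed.

Lemma size_vanishing_poly_le s : (size (vanishing_poly s) <= (size s).+1)%N.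
Proof. by rewrite -(size_vanishing_poly s) leq_addr. Qed.

(** Every divisor of degree zero on [P^1] is principal, and quotients of
    vanishing polynomials realise it, infinity included. *)
Lemma ordP1_vanishing_poly x s t : size s = size t ->
  ordP1 x (tofrac (vanishing_poly s) / tofrac (vanishing_poly t) : ratfun k) =
  (count_mem x s)%:Z - (count_mem x t)%:Z.
Proof.
move=> st; rewrite ordP1_div ?vanishing_poly_neq0 //.
case: x => [a|]; first by rewrite !mup_vanishing_poly.
have := size_vanishing_poly s; have := size_vanishing_poly t; rewrite -st.
set ct := (X in X - _ = _); set cs := (X in _ - X = _).
move=> <- /eqP; rewrite -eqz_nat !PoszD => /eqP E.
move: E; rewrite /cs /ct; lia.
Qed.

(** This is [L(y)] when [y] consists of two points. *)
Definition pole_space y : set (ratfun k) :=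
  range (lincomb (fun i : 'I_3 => tofrac 'X^i / tofrac (vanishing_poly y) : ratfun k)).

Lemma lincomb_vanishing_poly y (c : 'I_3 -> k) :
  lincomb (fun i : 'I_3 => tofrac 'X^i / tofrac (vanishing_poly y) : ratfun k) c =
  tofrac (\poly_(i < 3) c (inord i)) / tofrac (vanishing_poly y).
Proof.
rewrite /lincomb poly_def rmorph_sum mulr_suml; apply: eq_bigr => i _.
by rewrite inord_val mulrA -mul_polyC rmorphM.
Qed.

Lemma pole_spaceP y h : pole_space y h <->
  exists2 P : {poly k}, (size P <= 3)%N & h = tofrac P / tofrac (vanishing_poly y).
Proof.
split=> [[c _ <-]|[P sP ->]].
  by exists (\poly_(i < 3) c (inord i)); rewrite ?size_poly ?lincomb_vanishing_poly.
exists (fun i => P`_i) => //; rewrite lincomb_vanishing_poly; congr (tofrac _ / _).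
apply/polyP => i; rewrite coef_poly.
by case: ltnP => [i3|/(leq_trans sP) /leq_sizeP ->//]; rewrite inordK.
Qed.

Lemma pole_space_vanishing_poly y z : size z = 2%N ->
  pole_space y (tofrac (vanishing_poly z) / tofrac (vanishing_poly y)).
Proof.
move=> z2; apply/pole_spaceP; exists (vanishing_poly z) => //.
by rewrite (leq_trans (size_vanishing_poly_le _)) ?z2.
Qed.

Lemma pole_space_dim y : subspace_dim (pole_space y) 3.
Proof.
exists (fun i : 'I_3 => tofrac 'X^i / tofrac (vanishing_poly y) : ratfun k); split=> // c.
rewrite lincomb_vanishing_poly => /eqP; rewrite mulf_eq0 invr_eq0.
rewrite (negPf (tofrac_vanishing_poly_neq0 y)) orbF tofrac_eq0 => /eqP/polyP E i.
by have := E i; rewrite coef_poly ltn_ord inord_val coef0.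
Qed.

(** The numerator of [h] has degree at most 2. *)
Lemma ordP1_pole_space_le2 y h a : pole_space y h -> h != 0 ->
  ordP1 (Some a : P1 k) h <= 2.
Proof.
case/pole_spaceP=> P sP ->; rewrite mulf_eq0 negb_or tofrac_eq0 => /andP[P0 _].
rewrite ordP1_div ?vanishing_poly_neq0 // lerBlDr ler_wpDr // lez_nat.
rewrite -ltnS mup_ltn //; apply/negP => /(dvdp_leq P0).
by rewrite size_exp_XsubC leqNgt ltnS sP.
Qed.

(** An algebraically closed field is infinite. *)
Lemma fresh_point (s : seq (P1 k)) : exists a : k, (Some a : P1 k) \notin s.
Proof.
have /closed_nonrootP[a] := vanishing_poly_neq0 s; rewrite /vanishing_poly root_prod_XsubC => sa.
by exists a; apply: contra sa; rewrite /finite_part mem_pmap map_id.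
Qed.

End ProjectiveLine.

(** * Concave functions with two kinks on an edge *)

Section PiecewiseAffine.
Variable R : realType.
Implicit Types (g : R -> R) (a b t u x y z : R).

Definition piecewise_affine_on g x y : Prop :=
  exists (n : nat) (t : nat -> R),
    [/\ t 0%N = x, t n = y &
      forall i, (i < n)%N -> t i < t i.+1 /\
        exists s : int, forall u, t i <= u <= t i.+1 ->
          g u = g (t i) + s%:~R * (u - t i)].

Lemma piecewise_affine_on_cat y g x z :
  piecewise_affine_on g x y -> piecewise_affine_on g y z ->
  piecewise_affine_on g x z.
Proof.
case=> n [t [t0 tn tP]] [m [t' [t'0 t'm t'P]]].
exists (n + m)%N, (fun i => if (i < n)%N then t i else t' (i - n)%N); split.
- by case: n t0 tn {tP} => [|n] t0 tn //=; rewrite t'0 -tn.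
- by rewrite ltnNge leq_addr /= addKn.
move=> i inm; case: ltnP => [ni|ni]; last first.
  by rewrite ltnNge leqW //= subSn //; apply: t'P; rewrite ltn_subLR.
have -> : (if (i.+1 < n)%N then t i.+1 else t' (i.+1 - n)%N) = t i.+1.
  case: ltnP => // ni'; have eq_n : i.+1 = n by apply/eqP; rewrite eqn_leq ni ni'.
  by rewrite eq_n subnn t'0 tn.
exact: tP.
Qed.

Lemma affine_piecewise_affine_on g x y (s : int) : x <= y ->
  (forall u, x <= u <= y -> g u = g x + s%:~R * (u - x)) ->
  piecewise_affine_on g x y.
Proof.
rewrite le_eqVlt => /predU1P[<- _|xy gP]; first by exists 0%N, (fun=> x).
exists 1%N, (fun i => if i is 0%N then x else y); split=> // -[|//] _.
by split=> //; exists s.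
Qed.

(** The function on [0, 1] of value [h] at 0, of slope 1 at first, whose slope
    drops by one at each of the two chips [c.1] and [c.2].  Taken in this form,
    it does not depend on the order of the chips. *)
Definition profile h (c : R * R) u : R := h + Num.min u c.1 + Num.min u c.2 - u.

Definition chips_at (c : R * R) t : nat := (c.1 == t) + (c.2 == t).

Lemma profile_piecewise_affine h c g : 0 <= c.1 <= 1 -> 0 <= c.2 <= 1 ->
  (forall u, 0 <= u <= 1 -> g u = profile h c u) -> piecewise_affine g.
Proof.
wlog c12 : c / c.1 <= c.2 => [wlg|] c1 c2 gP.
  have [c12|/ltW c21] := leP c.1 c.2; first exact: (wlg c).
  apply: (wlg (c.2, c.1)) => // u u01; rewrite gP // /profile /=; lra.
case: c c12 c1 c2 gP => a b /= ab a01 b01 gP.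
have piece (s : int) x y : 0 <= x -> x <= y -> y <= 1 ->
    (forall u, x <= u <= y -> profile h (a, b) u = profile h (a, b) x + s%:~R * (u - x)) ->
    piecewise_affine_on g x y.
  move=> x0 xy y1 sP; apply: (affine_piecewise_affine_on (s := s)) => // u xuy.
  have u01 : 0 <= u <= 1 by lra.
  have x01 : 0 <= x <= 1 by lra.
  by rewrite (gP u u01) (gP x x01); exact: sP.
apply: (piecewise_affine_on_cat (y := b)); first apply: (piecewise_affine_on_cat (y := a)).
- apply: (piece 1) => [| | |u /andP[u0 ua]]; [lra|lra|lra|rewrite mul1r /profile /=].
  by rewrite (min_l ua) (min_l (le_trans ua ab)) !min_l; lra.
- apply: (piece 0) => [| | |u /andP[au ub]]; [lra|lra|lra|rewrite mul0r /profile /=].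
  by rewrite (min_r au) (min_l ub) minxx (min_l ab); lra.
- apply: (piece (-1)) => [| | |u /andP[bu u1]]; [lra|lra|lra|rewrite mulN1r /profile /=].
  by rewrite (min_r bu) (min_r (le_trans ab bu)) minxx (min_r ab); lra.
Qed.

Lemma near0_minD a t : \forall u \near (0 : R)^'+,
  Num.min (t + u) a = Num.min t a + (t < a)%R%:R * u.
Proof.
have [ta|ta] := ltP t a; near=> u.
  have ua : u <= a - t by near: u; apply: nbhs_right_le; rewrite subr_gt0.
  by rewrite mul1r min_l //; lra.
rewrite mul0r addr0 min_r // ler_wpDr //; near: u; exact: nbhs_right_ge.
Unshelve. all: by end_near. Qed.

Lemma near0_minB a t : \forall u \near (0 : R)^'+,
  Num.min (t - u) a = Num.min t a - (t <= a)%R%:R * u.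
Proof.
have [ta|ta] := leP t a; near=> u.
  have u0 : 0 <= u by near: u; exact: nbhs_right_ge.
  by rewrite mul1r min_l //; lra.
rewrite mul0r subr0 min_r //.
have ua : u <= t - a by near: u; apply: nbhs_right_le; rewrite subr_gt0.
lra.
Unshelve. all: by end_near. Qed.

Lemma slope_profileD h c g t : t < 1 -> 0 <= t ->
  (forall u, 0 <= u <= 1 -> g u = profile h c u) ->
  slope (fun u => g (t + u)) = (t < c.1)%R%:Z + (t < c.2)%R%:Z - 1.
Proof.
move=> t1 t0 gP; apply: slopeP; near=> u.
have u0 : 0 <= u by near: u; exact: nbhs_right_ge.
have ut : u <= 1 - t by near: u; apply: nbhs_right_le; rewrite ?subr_gt0.
rewrite !gP /profile; [|lra|lra].
rewrite addr0 rmorphB rmorphD /= -!pmulrn.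
have -> : Num.min (t + u) c.1 = Num.min t c.1 + (t < c.1)%R%:R * u.
  by near: u; exact: near0_minD.
have -> : Num.min (t + u) c.2 = Num.min t c.2 + (t < c.2)%R%:R * u.
  by near: u; exact: near0_minD.
lra.
Unshelve. all: by end_near. Qed.

Lemma slope_profileB h c g t : 0 < t -> t <= 1 ->
  (forall u, 0 <= u <= 1 -> g u = profile h c u) ->
  slope (fun u => g (t - u)) = 1 - (t <= c.1)%R%:Z - (t <= c.2)%R%:Z.
Proof.
move=> t1 t0 gP; apply: slopeP; near=> u.
have u0 : 0 <= u by near: u; exact: nbhs_right_ge.
have ut : u <= t by near: u; apply: nbhs_right_le; rewrite ?subr_gt0.
rewrite !gP /profile; [|lra|lra].
rewrite subr0 !rmorphB /= -!pmulrn.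
have -> : Num.min (t - u) c.1 = Num.min t c.1 - (t <= c.1)%R%:R * u.
  by near: u; exact: near0_minB.
have -> : Num.min (t - u) c.2 = Num.min t c.2 - (t <= c.2)%R%:R * u.
  by near: u; exact: near0_minB.
lra.
Unshelve. all: by end_near. Qed.

End PiecewiseAffine.

(** A metric function encoded by its values at the vertices and by two chips on
    each edge.  [chip_height] says that the profile starting at the height of
    one end of an edge reaches the height of the other end. *)
Section ChipConfiguration.
Variables (R : realType) (G : graph).

Record chip_config := ChipConfig {
  height : vertex G -> R;
  chip : edge G -> R * R;
  chip1_itv : forall eps, 0 <= (chip eps).1 <= 1;
  chip2_itv : forall eps, 0 <= (chip eps).2 <= 1;
  chip_height : forall eps, (chip eps).1 + (chip eps).2 =
    1 + height (endpt eps true) - height (endpt eps false)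
}.

Variable T : chip_config.

Definition edge_profile eps : R -> R :=
  profile (height T (endpt eps false)) (chip T eps).

Definition config_fun (x : metric_graph R G) : R :=
  match x with
  | inl v => height T v
  | inr (eps, t) => edge_profile eps (val t)
  end.

Lemma config_fun_edge eps u : 0 <= u <= 1 ->
  config_fun (edge_point eps u) = edge_profile eps u.
Proof.
move=> u01; rewrite /edge_point; case: insubP => [w _ <- //|u01'].
have := chip1_itv T eps; have := chip2_itv T eps; have := chip_height T eps.
move=> height_eps /andP[b0 b1] /andP[a0 a1]; rewrite /edge_profile /profile /=.
case: (leP 1 u) u01' => [u1 _|u1]; last rewrite andbT -leNgt => u0.
  have -> : u = 1 by lra.
  by rewrite !min_r //; lra.
have -> : u = 0 by lra.
by rewrite !min_l //; lra.
Qed.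

Lemma config_fun_pa eps :
  piecewise_affine (fun u => config_fun (edge_point eps u)).
Proof.
apply: profile_piecewise_affine (chip1_itv T eps) (chip2_itv T eps) _ => u.
exact: config_fun_edge.
Qed.

Variables (k : closedFieldType) (h : ratfun_mc R k G) (C : metrized_complex k G).
Hypothesis h_config : metric_part h = config_fun.

Let hE eps u : 0 <= u <= 1 -> metric_part h (edge_point eps u) = edge_profile eps u.
Proof. by rewrite h_config; exact: config_fun_edge. Qed.

Lemma ord_config_interior eps (t : {u : R | 0 < u < 1}) :
  ord C h (inl (eps, t)) = chips_at (chip T eps) (val t).
Proof.
have /andP[t0 t1] := valP t; rewrite /ord.
rewrite (slope_profileD t1 (ltW t0) (@hE eps)).
rewrite (slope_profileB t0 (ltW t1) (@hE eps)).
have leE x : (val t <= x)%R%:Z = (x == val t)%R%:Z + (val t < x)%R%:Z.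
  by case: ltgtP.
rewrite !leE /chips_at PoszD; ring.
Qed.

Lemma end_slope_config eps b :
  end_slope h eps b = 1 - (chips_at (chip T eps) b%:R)%:Z.
Proof.
have := chip1_itv T eps; have := chip2_itv T eps; rewrite /end_slope /chips_at.
case: b => /andP[a0 a1] /andP[b0 b1].
  rewrite (slope_profileB ltr01 (lexx 1) (@hE eps)).
  by rewrite /= !eq_le a1 b1 /= PoszD; ring.
have -> : (fun u => metric_part h (edge_point eps u)) =
    (fun u => metric_part h (edge_point eps (0 + u))).
  by apply/funext => u; rewrite add0r.
rewrite (slope_profileD ltr01 (lexx 0) (@hE eps)).
by rewrite !lt0r a0 b0 !andbT; do 2!case: eqP.
Qed.

End ChipConfiguration.

(** * Effectivity of the divisor at a vertex *)

Section VertexConditions.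
Variables (R : realType) (k : closedFieldType) (G : graph).
Variables (C : metrized_complex k G) (T : chip_config R G).
Implicit Types (v : vertex G) (p : P1 k) (w E z : seq (P1 k)).

Definition end_chips eps (b : bool) : nat := chips_at (chip T eps) b%:R.

Lemma end_chips0 eps : end_chips eps false = chips_at (chip T eps) 0.
Proof. by []. Qed.

Lemma end_chips1 eps : end_chips eps true = chips_at (chip T eps) 1.
Proof. by []. Qed.

(** What the metric part contributes to the divisor at a point of [C_v]: at a
    marked point, the number of chips at this end of the edge, minus one. *)
Definition mark_surplus v p : int :=
  \sum_(eps : edge G) \sum_(b : bool | (endpt eps b == v) && (mark C eps b == p))
    ((end_chips eps b)%:Z - 1).

Lemma mark_surplus_mark eps b :
  mark_surplus (endpt eps b) (mark C eps b) = (end_chips eps b)%:Z - 1.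
Proof.
rewrite /mark_surplus pair_big_dep /= (big_pred1 (eps, b)) // => -[eps' b'] /=.
apply/andP/eqP => [[/eqP ee /eqP mm]|[-> ->]]; last by rewrite !eqxx.
exact: mark_inj ee mm.
Qed.

Lemma mark_surplus_unmarked v p :
  (forall eps b, endpt eps b = v -> mark C eps b <> p) -> mark_surplus v p = 0.
Proof.
move=> unmarked; rewrite /mark_surplus big1 // => eps _.
by rewrite big1 // => b /andP[/eqP /unmarked mp /eqP].
Qed.

Lemma mark_surplus_ge (n : nat) v p :
  (forall eps b, endpt eps b = v -> mark C eps b = p -> 1 <= n + end_chips eps b)%N ->
  0%:Z <= n%:Z + mark_surplus v p.
Proof.
move=> nP.
have [[eps [b [ev mp]]]|unmarked] :=
    pselect (exists eps b, endpt eps b = v /\ mark C eps b = p).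
  by have := nP _ _ ev mp; rewrite -ev -mp mark_surplus_mark; lia.
rewrite mark_surplus_unmarked ?addr0 // => eps b ev mp.
by apply: unmarked; exists eps, b.
Qed.

(** [E] lists the points to be reached on [C_v] and [w] consists of the
    poles of [h_v] at marked points; [z] lists the zeros of [h_v].  A pole of
    [h_v] outside [w] is compensated by a chip of the divisor. *)
Definition served v w E : Prop :=
  exists2 z : seq (P1 k), size z = 2 &
    forall p, ((count_mem p E + count_mem p w)%N%:Z <=
               (count_mem p z)%:Z + mark_surplus v p).

(** The zeros cancel [w], and one more zero is available when [w] is a single
    point: it is used either to reach a point of [E] or to fill the marked
    point of the only edge that may lack a chip. *)
Lemma served_idle v w E eps0 b0 : endpt eps0 b0 = v ->
  (forall eps b, endpt eps b = v -> (eps, b) != (eps0, b0) -> 1 <= end_chips eps b)%N ->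
  (size w + size E <= 2)%N -> (size w + size E < 2 + end_chips eps0 b0)%N ->
  served v w E.
Proof.
move=> ev others le2 lt2; pose x0 := mark C eps0 b0.
exists (w ++ E ++ nseq (2 - (size w + size E)) x0).
  by rewrite !size_cat size_nseq; lia.
move=> p; rewrite !count_cat count_nseq /=.
suff : 0%:Z <= ((x0 == p) * (2 - (size w + size E)))%N%:Z + mark_surplus v p.
  by case: (x0 == p); rewrite ?mul1n ?mul0n; lia.
apply: mark_surplus_ge => eps b epsv mp.
have [[ee eb]|ne] := eqVneq (eps, b) (eps0, b0).
  by rewrite -mp /x0 ee eb eqxx; lia.
by have := others _ _ epsv ne; lia.
Qed.

(** The second chip of each edge cancels the poles in [w], so that both zeros
    are available; the zeros that [E] leaves go to the marked point of the
    exceptional edge, where up to two chips may be missing. *)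
Lemma served_saturated v w E eps0 b0 : endpt eps0 b0 = v ->
  (forall eps b, endpt eps b = v -> (eps, b) != (eps0, b0) -> 2 <= end_chips eps b)%N ->
  (size E <= 2)%N -> (size E <= end_chips eps0 b0)%N ->
  uniq w -> (forall p, p \in w -> exists eps b, endpt eps b = v /\ mark C eps b = p) ->
  served v w E.
Proof.
move=> ev others le2 le0 uw wP; pose x0 := mark C eps0 b0.
exists (E ++ nseq (2 - size E) x0).
  by rewrite !size_cat size_nseq; lia.
move=> p; rewrite !count_cat count_nseq (count_uniq_mem _ uw) /=.
have atmark eps b : endpt eps b = v -> mark C eps b = p ->
    (2 <= (x0 == p) * (2 - size E) + end_chips eps b)%N.
  move=> epsv mp; have [[ee eb]|ne] := eqVneq (eps, b) (eps0, b0).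
    by rewrite -mp /x0 ee eb eqxx; lia.
  by have := others _ _ epsv ne; lia.
set n := ((x0 == p) * _)%N in atmark *.
have [/wP[eps [b [epsv mp]]]|pw] := boolP (p \in w).
  by have := atmark _ _ epsv mp; rewrite -epsv -mp mark_surplus_mark; lia.
suff : 0%:Z <= n%:Z + mark_surplus v p by lia.
by apply: mark_surplus_ge => eps b epsv mp; have := atmark _ _ epsv mp; lia.
Qed.

Variables (y z : vertex G -> seq (P1 k)).

Lemma vanishing_ratio_neq0 v :
  tofrac (vanishing_poly (z v)) / tofrac (vanishing_poly (y v)) != 0 :> ratfun k.
Proof. by rewrite mulf_neq0 ?invr_eq0 ?tofrac_vanishing_poly_neq0. Qed.

Definition config_ratfun : ratfun_mc R k G :=
  RatfunMc (config_fun_pa T) vanishing_ratio_neq0.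

Lemma ord_config_curve v p : size (z v) = size (y v) ->
  ord C config_ratfun (inr (v, p)) =
  (count_mem p (z v))%:Z - (count_mem p (y v))%:Z + mark_surplus v p.
Proof.
move=> szy; rewrite /ord /= ordP1_vanishing_poly //; congr (_ + _).
rewrite /mark_surplus -sumrN; apply: eq_bigr => eps _.
rewrite -sumrN; apply: eq_bigr => b _.
by rewrite (@end_slope_config _ _ T) // opprB.
Qed.

End VertexConditions.

(** * Firing towards an element *)

Section Matroid.
Variable M : matroid.
Implicit Types (e : M) (f : flat M).

Lemma flat_through e e' : e != e' ->
  exists f : flat M, (e \in val f) /\ (e' \in val f).
Proof.
move=> /flat_pair[F [[FM eF e'F] _]].
by exists (exist _ F FM : flat M).
Qed.

Lemma flat_uniq e e' f f' : e != e' -> e \in val f -> e' \in val f ->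
  e \in val f' -> e' \in val f' -> f = f'.
Proof.
move=> /flat_pair[F [_ Funiq]] ef e'f ef' e'f'; apply: val_inj => /=.
by rewrite -(Funiq _ (And3 (valP f) ef e'f)) (Funiq _ (And3 (valP f') ef' e'f')).
Qed.

Lemma flat_two f : exists e e', [/\ e != e', e \in val f & e' \in val f].
Proof.
have /card_gt1P[e [e' [ef e'f ee']]] := flat_card (valP f).
by exists e, e'; split.
Qed.

Lemma flat_other f e : exists2 e', e' != e & e' \in val f.
Proof.
have [e1 [e2 [ne f1 f2]]] := flat_two f.
by have [e1e|ne1] := eqVneq e1 e; [exists e2; rewrite // -e1e eq_sym|exists e1].
Qed.

Lemma flat_exists : flat M.
Proof.
have /card_gt1P/cid[F /cid[F' [FM _ _]]] := flats_card M.
exact: (exist _ F FM).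
Qed.

Lemma flat_of e : exists f : flat M, e \in val f.
Proof.
have [e' ne _] := flat_other flat_exists e.
by have [f []] := flat_through ne; exists f.
Qed.

Variable R : realType.

(** [hub_height] is the height to which the hub is raised, and [push f] is how
    far the chip of the hub moves on its edge to [f].  The other elements stay at
    height 0, and their chips move by [level f], but at most to the end of the
    edge, towards [f].  The last two conditions say that no element sends its
    only chip along two edges. *)
Record firing := Firing {
  hub : M;
  hub_height : R;
  push : flat M -> R;
  level f := push f + (if hub \in val f then hub_height else 0);
  hub_height_ge0 : 0 <= hub_height;
  push_itv : forall f, 0 <= push f <= 1;
  level_le2 : forall f, level f <= 2;
  push_hub : forall f f', hub \in val f -> hub \in val f' ->
    0 < push f -> 0 < push f' -> f = f';
  level_other : forall e f f', e != hub -> e \in val f -> e \in val f' ->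
    0 < level f -> 0 < level f' -> f = f'
}.

Variable S : firing.

Definition firing_height (v : vertex (levi M)) : R :=
  match v with
  | inl e => if e == hub S then hub_height S else 0
  | inr f => Num.min 1 (level S f)
  end.

(** On an edge at the hub, the second chip comes from the flat and starts to
    move when [level f] exceeds 1. *)
Definition firing_chip (eps : edge (levi M)) : R * R :=
  let: (e, f) := val eps in
  if e == hub S then (push S f, Num.min 1 (2 - level S f))
  else (Num.min 1 (level S f), 1).

Lemma level_ge0 f : 0 <= level S f.
Proof.
have /andP[p0 _] := push_itv S f; have l0 := hub_height_ge0 S.
by rewrite /level; case: ifP => _; lra.
Qed.

Lemma firing_chip1_itv eps : 0 <= (firing_chip eps).1 <= 1.
Proof.
case: eps => -[e f] /= ef; rewrite /firing_chip /=.
case: eqP => _ /=; first exact: push_itv.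
by rewrite le_min ler01 level_ge0 ge_min lexx.
Qed.

Lemma firing_chip2_itv eps : 0 <= (firing_chip eps).2 <= 1.
Proof.
case: eps => -[e f] /= ef; rewrite /firing_chip /=.
case: eqP => _ /=; last by rewrite ler01 lexx.
by rewrite le_min ler01 ge_min lexx subr_ge0 level_le2.
Qed.

Lemma firing_chip_height eps : (firing_chip eps).1 + (firing_chip eps).2 =
  1 + firing_height (endpt eps true) - firing_height (endpt eps false).
Proof.
case: eps => -[e f] /= ef; rewrite /firing_chip /=.
have [ec|_] := eqVneq e (hub S) => /=; last by lra.
rewrite /level -ec ef; case: (leP 1 (push S f + hub_height S)) => l1.
  by rewrite min_r; lra.
by rewrite min_l; lra.
Qed.

Definition firing_config : chip_config R (levi M) :=
  ChipConfig firing_chip1_itv firing_chip2_itv firing_chip_height.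

Definition vanishes_at (g : flat M -> R) e : bool :=
  [forall f : flat M, (e \in val f) ==> (g f == 0)].

(** The number of points of an effective divisor that the firing can reach at a
    given place of the metric graph.  At an element it counts the zeros of [h_v]
    that are not needed elsewhere.  At a flat it is the number of chips that
    arrive along the edge of the hub (along any edge, if the hub is not on the
    flat), once all other edges have both chips there; before that, no point can
    be reached. *)
Definition capacity (m : metric_graph R (levi M)) : nat :=
  match m with
  | inl (inl e) =>
    if e == hub S then
      (if vanishes_at (push S) e then 1 + (hub_height S == 2)%R else 0)%N
    else vanishes_at (level S) e
  | inl (inr f) =>
    if 1 <= level S f then ((push S f == 1)%R + (level S f <= 1)%R)%N else 0%N
  | inr (eps, t) => chips_at (firing_chip eps) (val t)
  end.

Variables (k : closedFieldType) (C : metrized_complex k (levi M)).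

Definition incident e f (ef : e \in val f) : edge (levi M) := exist _ (e, f) ef.

Definition marks_at (v : vertex (levi M)) (w : seq (P1 k)) :=
  uniq w /\ forall p, p \in w -> exists eps b, endpt eps b = v /\ mark C eps b = p.

(** Below level 1 every edge at [f] has a chip there.  From level 1 on, all edges
    but that of the hub have two chips at [f]. *)
Lemma flat_served f w E : marks_at (inr f) w -> size w = 2%N ->
  (size E <= capacity (inl (inr f)))%N -> served C firing_config (inr f) w E.
Proof.
move=> [uw wP] sw; rewrite [capacity _]/=; case: (leP 1 (level S f)) => [l1|l1 sE].
- move=> sE.
  (* The edge of the hub if there is one, and any edge otherwise. *)
  have [eps0 [ev0 E0 other]] : exists eps0 : edge (levi M), [/\ endpt eps0 true = inr f,
      (size E <= end_chips firing_config eps0 true)%N &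
      forall eps : edge (levi M), (val eps).2 = f -> eps != eps0 -> (val eps).1 != hub S].
    have [cf|cf] := boolP (hub S \in val f).
      exists (incident cf); split=> //.
        rewrite end_chips1 /chips_at /= /firing_chip /= eqxx /=.
        apply: leq_trans sE _; rewrite leq_add2l.
        by case: leP => // l1'; rewrite min_l ?eqxx //; lra.
      move=> [[e f'] /= ef] /= ff' ne; apply: contra ne => /eqP ec.
      by apply/eqP/val_inj; rewrite /= ec ff'.
    have [e [_ [_ ef _]]] := flat_two f.
    exists (incident ef); split=> //.
      rewrite end_chips1 /chips_at /= /firing_chip /= ifF; last first.
        by apply/eqP => ec; rewrite -ec ef in cf.
      rewrite /= min_l // eqxx; apply: leq_trans sE _.
      by do 2!case: (_ == _) || case: (_ <= _).
    move=> [[e' f'] /= ef'] /= ff' _; apply/eqP => ec.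
    by move: cf; rewrite -ec -ff' ef'.
  apply: (served_saturated ev0) => //.
    move=> [[e' f'] ef'] [] //= [ff'] ne.
    rewrite end_chips1 /chips_at /= /firing_chip /= ifF; last first.
      apply/negP/negP; apply: (other (exist _ (e', f') ef')) => //.
      by apply: contra ne => /eqP ->.
    by rewrite ff' min_l ?eqxx.
  apply: leq_trans sE _.
  by do 2!case: (_ == _) || case: (_ <= _).
have -> : E = [::] by case: E sE.
have [e [_ [_ ef _]]] := flat_two f.
have one (eps : edge (levi M)) : endpt eps true = inr f -> (0 < end_chips firing_config eps true)%N.
  case: eps => [[e' f'] ef'] /= [ff'].
  rewrite end_chips1 /chips_at /= /firing_chip /=; case: (e' == hub S) => /=.
    by rewrite min_l ?eqxx ?addn1 //; rewrite ff'; lra.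
  by rewrite eqxx addn1.
have ev : endpt (incident ef) true = inr f by [].
apply: (served_idle C ev); last 2 first.
- by rewrite sw.
- by rewrite sw -addn1 leq_add2l; exact: one.
- by move=> eps [] //= /one.
Qed.

(** An element sends its chip along at most one edge, so it is idle, except for
    the hub raised to height 2, where a chip arrives along every edge. *)
Lemma element_served e w E : marks_at (inl e) w -> size w = 1%N ->
  (size E <= capacity (inl (inl e)))%N -> served C firing_config (inl e) w E.
Proof.
move=> [uw wP] sw; rewrite [capacity _]/= => sE.
have chipsE (eps : edge (levi M)) : endpt eps false = inl e ->
    end_chips firing_config eps false =
    if e == hub S then
      ((push S (val eps).2 == 0%R) + (level S (val eps).2 == 2)%R)%N
    else (level S (val eps).2 == 0%R).
  case: eps => [[e' f'] ef'] /= [e'e]; rewrite -{}e'e {e w E uw wP sw sE} in ef' *.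
  rewrite end_chips0 /chips_at /= /firing_chip /=; case: (e' == hub S) => /=.
    case: leP => l2; congr (_ + nat_of_bool _)%N; last by rewrite subr_eq0 eq_sym.
    by rewrite oner_eq0; apply/esym/eqP; lra.
  rewrite oner_eq0 addn0; case: leP => // l1.
  by rewrite oner_eq0; congr nat_of_bool; apply/esym/eqP; lra.
have half : exists2 eps0 : edge (levi M), endpt eps0 false = inl e &
    (0 < size E -> 0 < end_chips firing_config eps0 false)%N /\
    (forall eps : edge (levi M), endpt eps false = inl e -> eps != eps0 ->
      0 < end_chips firing_config eps false)%N.
  (* [g] measures how far the chip of [e] moves along the edge to each flat. *)
  have [g [g0 guniq gvan gchips]] : exists g : flat M -> R,
      [/\ forall f, 0 <= g f,
          forall f f', e \in val f -> e \in val f' -> 0 < g f -> 0 < g f' -> f = f',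
          (0 < size E)%N -> vanishes_at g e &
          forall eps : edge (levi M), endpt eps false = inl e ->
            g (val eps).2 = 0 -> (0 < end_chips firing_config eps false)%N].
    have [ec|ec] := boolP (e == hub S).
      exists (push S); split=> [f|f f'||eps epsv pe].
      - by case/andP: (push_itv S f).
      - rewrite (eqP ec); exact: push_hub.
      - by move: sE; rewrite ec; case: ifP => // _; case: (size E).
      - by rewrite chipsE // ec pe eqxx.
    exists (level S); split=> [|f f'||eps epsv le].
    - exact: level_ge0.
    - exact: level_other.
    - by move: sE; rewrite (negPf ec); case: (vanishes_at _ _) => //; case: (size E).
    - by rewrite chipsE // (negPf ec) le eqxx.
  have [van|] := boolP (vanishes_at g e).
    have [f ef] := flat_of e; exists (incident ef) => //.
    have all (eps : edge (levi M)) : endpt eps false = inl e ->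
        (0 < end_chips firing_config eps false)%N.
      move=> epsv; apply: gchips => //; apply/eqP; move/forallP: van => /(_ (val eps).2).
      by case: eps epsv => [[e' f'] ef'] /= [e'e]; rewrite -e'e ef'.
    by split=> [_|eps epsv _]; exact: all.
  rewrite negb_forall => /existsP[f]; rewrite negb_imply => /andP[ef gf].
  exists (incident ef) => //; split=> [/gvan/forallP/(_ f)|].
    by rewrite ef (negPf gf).
  case=> [[e' f'] ef'] epsv ne; apply: gchips => //=.
  case: epsv => /= e'e; apply/eqP; apply: contraNT ne => gf'; apply/eqP/val_inj => /=.
  rewrite e'e; congr (_, _); apply: guniq; rewrite ?lt0r ?gf' ?gf ?g0 //.
  by rewrite -e'e; exact: ef'.
have [eps0 ev0 [E0 other]] := half.
have idle : (size E <= 1)%N -> served C firing_config (inl e) w E.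
  move=> sE1; apply: (served_idle C ev0); last 2 first.
  - by rewrite sw.
  - by rewrite sw; case: (size E) E0 sE1 => [|[|//]] // /(_ isT); lia.
  by move=> eps [] // epsv ne; apply: other => //; apply: contra ne => /eqP ->.
move: sE; have [ec|ec] := boolP (e == hub S); last first.
  by move=> /leq_trans le; apply/idle/le; case: (vanishes_at _ _).
case: ifP => [/forallP van|_ sE]; last exact/idle/(leq_trans sE).
case: (eqVneq (hub_height S) 2) => [l2|_ sE]; last exact: idle.
rewrite /= => sE.
have two (eps : edge (levi M)) : endpt eps false = inl e ->
    end_chips firing_config eps false = 2%N.
  move=> epsv; rewrite chipsE // ec; case: eps epsv => [[e' f'] ef'] /= [e'e].
  have := van f'; rewrite -e'e ef' /level => /eqP ->.
  by rewrite eqxx add0r -(eqP ec) -e'e ef' l2 eqxx.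
apply: (served_saturated ev0) => //; last by rewrite two.
by move=> eps [] // /two ->.
Qed.

End Matroid.

(** * Two points of the metric graph *)

Section TwoPoints.
Variables (R : realType) (M : matroid).
Implicit Types (e : M) (f g : flat M) (a b c : R).

(** Two flats at another element [e] that are both raised contain the hub, so
    they are equal. *)
Lemma pencil_firing e0 f c a : e0 \in val f -> 0 <= c -> 0 <= a <= 1 -> c + a <= 2 ->
  exists S : firing M R, [/\ hub S = e0, hub_height S = c &
    forall g, push S g = if g == f then a else 0].
Proof.
move=> ef c0 /andP[a0 a1] ca2.
pose p (g : flat M) : R := if g == f then a else 0.
have level_through (g : flat M) : 0 < p g + (if e0 \in val g then c else 0) -> e0 \in val g.
  by rewrite /p; case: eqP => [->//|_]; case: (e0 \in val g) => //; rewrite addr0 ltxx.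
unshelve eexists (@Firing M R e0 c p c0 _ _ _ _); last by split.
- by move=> g; rewrite /p; case: ifP => _; rewrite ?a0 ?a1 ?lexx ?ler01.
- move=> g /=; rewrite /p; case: ifP => _; case: ifP => _; lra.
- by move=> g g' _ _; rewrite /p; do 2!(case: eqP => [->|_]; rewrite ?ltxx).
- by move=> e g g' ne eg eg' /level_through e0g /level_through e0g'; exact: (flat_uniq ne).
Qed.

Lemma disjoint_firing f f' a b : (forall e, e \in val f -> e \in val f' -> False) ->
  0 <= a <= 1 -> 0 <= b <= 1 ->
  exists S : firing M R, level S f = a /\ level S f' = b /\ hub_height S = 0
    /\ push S f = a /\ push S f' = b.
Proof.
move=> dis a01 b01; have [e0 [_ [_ e0f _]]] := flat_two f.
have f'f : f' != f by apply: contraPneq dis => -> /(_ _ e0f e0f).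
pose p (g : flat M) : R := if g == f then a else if g == f' then b else 0.
(* No element lies on both flats. *)
have p_uniq e (g g' : flat M) : e \in val g -> e \in val g' -> 0 < p g -> 0 < p g' -> g = g'.
  rewrite /p; do 2!(case: eqP => [->|_]; [|case: eqP => [->|_]]) => //; rewrite ?ltxx //.
    by move=> /dis h /h.
  by move=> eg' /dis /(_ eg').
unshelve eexists (@Firing M R e0 0 p (lexx 0) _ _ _ _).
- by move=> g; rewrite /p; do 2!case: ifP => // _; rewrite lexx ler01.
- by move=> g; rewrite /= if_same addr0 /p; case: ifP => _; [|case: ifP => _]; lra.
- by move=> g g'; exact: p_uniq.
- by move=> e g g' _ /= eg eg'; rewrite !if_same !addr0; exact: (p_uniq e).
by rewrite /level /= !if_same !addr0 /p !eqxx (negPf f'f).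
Qed.

Lemma capacity_level1 (S : firing M R) f : level S f = 1 -> (0 < capacity S (inl (inr f)))%N.
Proof. by rewrite /= => ->; rewrite lexx addn1. Qed.

Lemma capacity_hub_edge (S : firing M R) (eps : edge (levi M)) t :
  (val eps).1 = hub S -> capacity S (inr (eps, t)) =
  ((push S (val eps).2 == val t)%R + (Num.min 1 (2 - level S (val eps).2) == val t)%R)%N.
Proof. by case: eps => -[e f] ef /= ec; rewrite /firing_chip /= ec eqxx. Qed.

Lemma capacity_edge (S : firing M R) (eps : edge (levi M)) t :
  (val eps).1 != hub S -> level S (val eps).2 = val t ->
  (0 < capacity S (inr (eps, t)))%N.
Proof.
case: eps => -[e f] ef /= ec lt; rewrite /firing_chip /= (negPf ec) lt.
by case/andP: (valP t) => _ /ltW t1; rewrite /chips_at /= min_r // eqxx.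
Qed.

Lemma capacity_push (S : firing M R) (eps : edge (levi M)) t :
  (val eps).1 = hub S -> push S (val eps).2 = val t ->
  (0 < capacity S (inr (eps, t)))%N.
Proof. by move=> /capacity_hub_edge -> ->; rewrite eqxx. Qed.

Lemma capacity_level (S : firing M R) (eps : edge (levi M)) t :
  (val eps).1 = hub S -> level S (val eps).2 = 2 - val t ->
  (0 < capacity S (inr (eps, t)))%N.
Proof.
move=> /capacity_hub_edge -> ->; case/andP: (valP t) => _ /ltW t1.
by rewrite opprB addrC subrK min_r // eqxx addn1.
Qed.

Lemma capacity_free (S : firing M R) e :
  (forall f, e \in val f -> level S f = 0) -> hub_height S = 0 ->
  (0 < capacity S (inl (inl e)))%N.
Proof.
move=> l0 c0 /=; have lv : vanishes_at (level S) e.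
  by apply/forallP => f; apply/implyP => /l0 ->.
have pv : vanishes_at (push S) e.
  by apply/forallP => f; apply/implyP => /l0; rewrite /level c0 if_same addr0 => ->.
by case: ifP; rewrite ?lv ?pv.
Qed.

Lemma capacity_hub (S : firing M R) : (forall f, push S f = 0) ->
  capacity S (inl (inl (hub S))) = (1 + (hub_height S == 2)%R)%N.
Proof.
move=> p0; rewrite /= eqxx ifT //; apply/forallP => f; apply/implyP => _.
by rewrite p0.
Qed.

Definition carries (m1 m2 : metric_graph R (levi M)) : Prop :=
  exists S : firing M R,
    [/\ (0 < capacity S m1)%N, (0 < capacity S m2)%N &
        m1 = m2 -> (1 < capacity S m1)%N].

Lemma carriesC m1 m2 : carries m1 m2 -> carries m2 m1.
Proof. by case=> S [h1 h2 h3]; exists S; split=> // E; rewrite E h3. Qed.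

Let one01 : (0 : R) <= (1 : R) <= 1. Proof. by apply/andP; split. Qed.
Let zero01 : (0 : R) <= (0 : R) <= 1. Proof. by apply/andP; split. Qed.

Lemma hub_firing e c : 0 <= c <= 2 ->
  exists S : firing M R, [/\ hub S = e, hub_height S = c, forall g, push S g = 0 &
     forall g, e \in val g -> level S g = c].
Proof.
move=> /andP[c0 c2]; have [f ef] := flat_of e.
have [|S [ec lc p0]] := pencil_firing ef c0 zero01; first by rewrite addr0.
have {}p0 (g : flat M) : push S g = 0 by rewrite p0 if_same.
by exists S; split=> // g eg; rewrite /level p0 ec eg lc add0r.
Qed.

Lemma carries_elements e e' : carries (inl (inl e)) (inl (inl e')).
Proof.
have [ee|ne] := eqVneq e e'.
  have [|S [ec lc p0 _]] := @hub_firing e 2; first by rewrite ler0n lexx.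
  by exists S; rewrite -ee -ec (capacity_hub p0) lc eqxx.
have [|S [ec lc p0 _]] := @hub_firing e 0; first by rewrite lexx ler0n.
have l0 (g : flat M) : level S g = 0 by rewrite /level p0 lc if_same addr0.
exists S; split; [exact: capacity_free|exact: capacity_free|].
by case=> E; rewrite E eqxx in ne.
Qed.

Lemma level_pencil (S : firing M R) e0 f c a g :
  [/\ hub S = e0, hub_height S = c & forall g, push S g = if g == f then a else 0] ->
  e0 \in val g -> level S g = c + (if g == f then a else 0).
Proof. by case=> ec lc pS eg; rewrite /level pS ec lc eg addrC. Qed.

Lemma carries_element_flat e f : carries (inl (inl e)) (inl (inr f)).
Proof.
have [ef|ef] := boolP (e \in val f).
  have [|S [ec lc p0 lS]] := @hub_firing e 1; first by rewrite ler01 ler1n.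
  exists S; split=> //; last by apply: capacity_level1; exact: lS.
  by rewrite -ec (capacity_hub p0).
have [e1 [_ [_ e1f _]]] := flat_two f.
have [|S SP] := pencil_firing e1f (lexx 0) one01; first by rewrite add0r ler1n.
exists S; split=> //; last first.
  by apply: capacity_level1; rewrite (level_pencil SP e1f) eqxx add0r.
case: SP => ec lc pS; apply: capacity_free => // g eg.
rewrite /level pS lc if_same addr0 ifF //.
by apply: contraNF ef => /eqP <-.
Qed.

Lemma flat_meet f f' :
  (exists2 e, e \in val f & e \in val f') \/ (forall e, e \in val f -> e \in val f' -> False).
Proof.
have [|no] := pselect (exists2 e, e \in val f & e \in val f'); first by left.
by right=> e ef ef'; apply: no; exists e.
Qed.

Lemma carries_flats f f' : carries (inl (inr f)) (inl (inr f')).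
Proof.
have [<-|ne] := eqVneq f f'.
  have [e1 [_ [_ e1f _]]] := flat_two f.
  have [|S SP] := pencil_firing e1f (lexx 0) one01; first by rewrite add0r ler1n.
  have l1 : level S f = 1 by rewrite (level_pencil SP e1f) eqxx add0r.
  by exists S; rewrite /= l1 lexx; case: SP => _ _ ->; rewrite !eqxx.
have [[e ef ef']|dis] := flat_meet f f'.
  have [|S [ec lc p0 lS]] := @hub_firing e 1; first by rewrite ler01 ler1n.
  exists S; split; [exact/capacity_level1/lS|exact/capacity_level1/lS|].
  by case=> E; rewrite E eqxx in ne.
have [S [l1 [l1' _]]] := disjoint_firing dis one01 one01.
exists S; split; [exact: capacity_level1|exact: capacity_level1|].
by case=> E; rewrite E eqxx in ne.
Qed.

Lemma carries_element_edge e (eps : edge (levi M)) t :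
  carries (inl (inl e)) (inr (eps, t)).
Proof.
have /andP[] := valP t; move aE : (val t) => a t0 t1.
have e'f' : (val eps).1 \in val (val eps).2 := valP eps.
set e' := (val eps).1 in e'f'; set f' := (val eps).2 in e'f'.
have [ef'|ef'] := boolP (e \in val f'); last first.
  have [|||S SP] := @pencil_firing e' f' 0 a e'f'; [clear -t0 t1; lra..|].
  exists S; split=> //; case: (SP) => ec lc pS.
    apply: capacity_free => // g eg; rewrite /level pS lc if_same addr0 ifF //.
    by apply: contraNF ef' => /eqP <-.
  by apply: capacity_push; rewrite ?ec // pS eqxx.
have [ee'|ne] := eqVneq e e'.
  have [|S [ec lc p0 lS]] := @hub_firing e (2 - a); first by clear -t0 t1; lra.
  exists S; split=> //; first by rewrite -{1}ec (capacity_hub p0).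
  by apply: capacity_level; rewrite ?ec ?lS ?aE // -ee'.
have [|S [ec lc p0 lS]] := @hub_firing e a; first by clear -t0 t1; lra.
exists S; split=> //; first by rewrite -{1}ec (capacity_hub p0).
by apply: capacity_edge; rewrite ?ec ?lS // eq_sym.
Qed.

Lemma carries_flat_edge f (eps : edge (levi M)) t :
  carries (inl (inr f)) (inr (eps, t)).
Proof.
have /andP[] := valP t; move aE : (val t) => a t0 t1.
have e'f' : (val eps).1 \in val (val eps).2 := valP eps.
set e' := (val eps).1 in e'f'; set f' := (val eps).2 in e'f'.
have [ff'|ne] := eqVneq f f'.
  have [|||S SP] := @pencil_firing e' f' (1 - a) a e'f'; [clear -t0 t1; lra..|].
  exists S; split=> //.
    by apply: capacity_level1; rewrite ff' (level_pencil SP e'f') eqxx subrK.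
  by case: SP => ec lc pS; apply: capacity_push; rewrite ?ec // pS eqxx.
have [[e ef ef']|dis] := flat_meet f f'; last first.
  have t01 : 0 <= a <= 1 by clear -t0 t1; lra.
  have [S [l1 [l1' [lS [p1 p1']]]]] := disjoint_firing dis one01 t01.
  exists S; split=> //; first exact: capacity_level1.
  have [ec|ec] := eqVneq e' (hub S); first by apply: capacity_push => //; rewrite p1'.
  by apply: capacity_edge => //; rewrite l1'.
have [ee'|nee'] := eqVneq e e'.
  have [|||S SP] := @pencil_firing e' f' 1 a e'f'; [clear -t0 t1; lra..|].
  exists S; split=> //.
    by apply: capacity_level1; rewrite (level_pencil SP) -?ee' // (negPf ne) addr0.
  by case: SP => ec lc pS; apply: capacity_push; rewrite ?ec // pS eqxx.
have [|||S SP] := @pencil_firing e f a (1 - a) ef; [clear -t0 t1; lra..|].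
exists S; split=> //.
  by apply: capacity_level1; rewrite (level_pencil SP ef) eqxx addrC subrK.
apply: capacity_edge; first by case: SP => -> _ _; rewrite eq_sym.
by rewrite (level_pencil SP ef') eq_sym (negPf ne) addr0.
Qed.

(** The hub is chosen on both flats whenever they meet.  If an edge contains the
    hub, then its interior is reached either by the chip that leaves the hub
    ([capacity_push]) or by the one that arrives there ([capacity_level]).
    Otherwise it is reached by the chip of its own element, provided that the
    level is the distance to that element ([capacity_edge]). *)
Lemma carries_edges_le (eps eps' : edge (levi M)) t t' : val t <= val t' ->
  carries (inr (eps, t)) (inr (eps', t')).
Proof.
have /andP[] := valP t; have /andP[] := valP t'.
move aE : (val t) => a; move bE : (val t') => b b0 b1 a0 a1 ab.
have ef : (val eps).1 \in val (val eps).2 := valP eps.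
have e'f' : (val eps').1 \in val (val eps').2 := valP eps'.
have [eps_eq|eps_ne] := eqVneq eps eps'.
  have [|||S SP] := @pencil_firing _ _ (2 - a - b) a ef; [clear -a0 a1 b0 b1 ab; lra..|].
  have lS : level S (val eps').2 = 2 - b.
    by rewrite -eps_eq (level_pencil SP ef) eqxx; clear; lra.
  case: SP => ec lc pS; exists S; split.
  - by apply: capacity_push; rewrite ?ec // pS eqxx.
  - by apply: capacity_level; rewrite ?ec ?lS ?bE ?eps_eq.
  case=> _ t_eq; have ab_eq : a = b by rewrite -aE -bE t_eq.
  rewrite capacity_hub_edge ?ec // pS eqxx eps_eq lS aE -ab_eq.
  by rewrite opprB addrC subrK min_r ?eqxx // ltW.
have eps_neE : (val eps).1 = (val eps').1 -> (val eps).2 = (val eps').2 -> False.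
  move=> E1 E2; case/eqP: eps_ne; apply: val_inj.
  by rewrite [LHS]surjective_pairing E1 E2 -surjective_pairing.
suff [S [c1 c2]] : exists S : firing M R,
    (0 < capacity S (inr (eps, t)))%N /\ (0 < capacity S (inr (eps', t')))%N.
  by exists S; split=> // -[E]; rewrite E eqxx in eps_ne.
have [ff'|ne] := eqVneq (val eps).2 (val eps').2.
  have [|||S SP] := @pencil_firing _ _ (b - a) a ef; [clear -a0 a1 b0 b1 ab; lra..|].
  have lS : level S (val eps').2 = b.
    by rewrite -ff' (level_pencil SP ef) eqxx; clear; lra.
  case: SP => ec lc pS; exists S; split.
    by apply: capacity_push; rewrite ?ec // pS eqxx.
  apply: capacity_edge; last by rewrite lS.
  by rewrite ec; apply/eqP => /esym/eps_neE/(_ ff').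
have [[e0 e0f e0f']|dis] := flat_meet (val eps).2 (val eps').2; last first.
  have t01 : 0 <= a <= 1 by clear -a0 a1 b0 b1; lra.
  have t'01 : 0 <= b <= 1 by clear -a0 a1 b0 b1; lra.
  have [S [l1 [l1' [lS [p1 p1']]]]] := disjoint_firing dis t01 t'01.
  exists S; split.
    have [ec|ec] := eqVneq (val eps).1 (hub S); first by apply: capacity_push => //; rewrite p1.
    by apply: capacity_edge => //; rewrite l1.
  have [ec|ec] := eqVneq (val eps').1 (hub S); first by apply: capacity_push => //; rewrite p1'.
  by apply: capacity_edge => //; rewrite l1'.
have [e_eq|e_ne] := eqVneq (val eps).1 e0; have [e'_eq|e'_ne] := eqVneq (val eps').1 e0.
- have [|||S SP] := @pencil_firing _ _ (2 - b) a ef; [clear -a0 a1 b0 b1 ab; lra..|].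
  have lS : level S (val eps').2 = 2 - b.
    by rewrite (level_pencil SP) ?e_eq // eq_sym (negPf ne) addr0.
  case: SP => ec lc pS; exists S; split.
    by apply: capacity_push; rewrite ?ec // pS eqxx.
  by apply: capacity_level; rewrite ?ec ?lS ?bE ?e_eq.
- have [|||S SP] := @pencil_firing _ _ b a ef; [clear -a0 a1 b0 b1 ab; lra..|].
  have lS : level S (val eps').2 = b.
    by rewrite (level_pencil SP) ?e_eq // eq_sym (negPf ne) addr0.
  case: SP => ec lc pS; exists S; split.
    by apply: capacity_push; rewrite ?ec // pS eqxx.
  by apply: capacity_edge; rewrite ?ec ?e_eq ?lS.
- have [|||S SP] := @pencil_firing _ _ a b e'f'; [clear -a0 a1 b0 b1 ab; lra..|].
  have lS : level S (val eps).2 = a.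
    by rewrite (level_pencil SP) ?e'_eq // (negPf ne) addr0.
  case: SP => ec lc pS; exists S; split.
    by apply: capacity_edge; rewrite ?ec ?e'_eq ?lS.
  by apply: capacity_push; rewrite ?ec // pS eqxx.
- have [|||S SP] := @pencil_firing e0 (val eps').2 a (b - a) e0f'; [clear -a0 a1 b0 b1 ab; lra..|].
  have lS : level S (val eps).2 = a.
    by rewrite (level_pencil SP e0f) (negPf ne) addr0.
  have lS' : level S (val eps').2 = b.
    by rewrite (level_pencil SP e0f') eqxx; clear; lra.
  case: SP => ec lc pS; exists S; split.
    by apply: capacity_edge; rewrite ?ec ?lS.
  by apply: capacity_edge; rewrite ?ec ?lS'.
Qed.

Lemma carries_two_points m1 m2 : carries m1 m2.
Proof.
case: m1 m2 => [[e|f]|[eps t]] [[e'|f']|[eps' t']];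
  try by [exact: carries_elements|exact: carries_element_flat|exact: carries_element_edge
         |exact: carries_flats|exact: carries_flat_edge
         |exact/carriesC/carries_element_flat|exact/carriesC/carries_element_edge
         |exact/carriesC/carries_flat_edge].
have [tt'|/ltW tt'] := leP (val t) (val t'); first exact: carries_edges_le.
exact/carriesC/carries_edges_le.
Qed.

End TwoPoints.

(** * The limit linear series *)

Lemma effective_deg2 (K : choiceType) (E : {freeg K / int}) :
  fgle 0 E -> deg E = 2 -> exists p q, E = << p >> + << q >>.
Proof.
move=> E0 E2.
have [p pE] : exists p, p \in dom E.
  case domE : (dom E) => [|p s]; last by exists p; rewrite mem_head.
  by move: E2; move/eqP: domE; rewrite dom_eq0 => /eqP ->; rewrite deg0.
have Ep : fgle 0 (E - << p >>).
  apply/fgposP => z; rewrite coeffB coeffU mul1r; move/fgposP/(_ z): E0.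
  have [<-|_] := eqVneq p z; last by rewrite subr0.
  by move: pE; rewrite mem_dom; move: (coeff p E) => c; lia.
have [|q Eq] := deg1pos Ep; first by rewrite degB E2 degU.
by exists p, q; rewrite -Eq addrC subrK.
Qed.

Section CurvePoints.
Variables (R : realType) (k : closedFieldType) (G : graph).
Implicit Types (v : vertex G) (s : seq (point R k G)).

Definition place (x : point R k G) : metric_graph R G :=
  match x with inl y => inr y | inr (v, _) => inl v end.

Definition points_on v s : seq (P1 k) :=
  pmap (fun x : point R k G => if x is inr (w, p) then
    (if w == v then Some p else None) else None) s.

Lemma size_points_on v s : size (points_on v s) = count_mem (inl v) (map place s).
Proof.
elim: s => [|[y|[w p]] s IHs] //=; rewrite -IHs.
have [->|ne] := eqVneq w v; first by rewrite eqxx.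
by case: eqP => // -[wv]; rewrite wv eqxx in ne.
Qed.

Lemma count_points_on v s p : count_mem p (points_on v s) = count_mem (inr (v, p)) s.
Proof.
elim: s => [|[y|[w q]] s IHs] //=; rewrite -IHs.
have [->|ne] := eqVneq w v => /=.
  congr (_ + _)%N; congr nat_of_bool.
  by apply/eqP/eqP => [->|[]].
by rewrite (_ : _ == _ = false) //; apply/eqP => -[wv]; rewrite wv eqxx in ne.
Qed.

Lemma count_place_interior y s : count_mem (inl y) s = count_mem (inr y) (map place s).
Proof.
elim: s => [|[y'|[w q]] s IHs] //=; rewrite -IHs; congr (_ + _)%N.
Qed.

(** The divisor to subtract is concentrated at one general point of [C_v], where
    neither [D] nor the metric part of a function contributes. *)
Lemma refined_rank_le2 (C : metrized_complex k G) (D : divisor R k G) H v y r :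
  H v = pole_space y -> refined_rank_ge C D H r -> r <= 2.
Proof.
move=> Hv rank_r; rewrite leNgt; apply/negP => r2.
pose marks := [seq mark C j.1 j.2 | j <- enum {: edge G * bool}].
have [a] := fresh_point (marks ++ points_on v (dom D)).
rewrite mem_cat negb_or => /andP[a_unmarked aD].
pose x : point R k G := inr (v, Some a).
have [||h [hH /(_ x)]] := rank_r << r *g x >>.
- by apply/fgposP => z; rewrite coeffU; lia.
- by rewrite degU.
have -> : coeff x (D - << r *g x >>) = - r.
  rewrite coeffB coeffU eqxx mulr1 coeff_outdom ?sub0r //.
  by move: aD; rewrite -!has_pred1 !has_count count_points_on.
rewrite /ord /= big1 => [|eps _]; last first.
  rewrite big1 // => b /andP[_ /eqP ma]; case/negP: a_unmarked.
  by apply/mapP; exists (eps, b); rewrite ?mem_enum //= ma.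
have := hH v; rewrite Hv => /(@ordP1_pole_space_le2 _ _ _ a)/(_ (curve_part_neq0 h v)) ord_le2.
by rewrite subr0 addrC subr_ge0 => /le_trans/(_ ord_le2); rewrite leNgt r2.
Qed.

End CurvePoints.

Section Final.
Variables (R : realType) (k : closedFieldType) (M : matroid).
Variable C : metrized_complex k (levi M).

(** The divisor puts a chip at each of these points, so that it absorbs the pole
    which the functions in [H_v] are allowed there. *)
Definition base_points (v : vertex (levi M)) : seq (P1 k) :=
  if v is inl _ then [:: None] else [::].

Definition divisor_at_infinity : divisor R k (levi M) :=
  \sum_(e : M) << (inr (inl e, None) : point R k (levi M)) >>.

Lemma coeff_divisor_at_infinity x :
  coeff x divisor_at_infinity =
  (if x is inr (v, p) then count_mem p (base_points v) else 0%N)%:Z.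
Proof.
rewrite /divisor_at_infinity raddf_sum /=.
under eq_bigr do rewrite coeffU mul1r.
case: x => [y|[[e|f] p]] /=; [by rewrite big1| |by rewrite big1].
rewrite (bigD1 e) //= big1 => [|e' ne].
  rewrite addr0 addn0 natz; congr (nat_of_bool _)%:Z.
  by apply/eqP/eqP => [[]|->].
by case: eqP => // -[ee]; rewrite ee eqxx in ne.
Qed.

Lemma marks_at_exist (v : vertex (levi M)) :
  exists w, marks_at C v w /\ size w = (2 - size (base_points v))%N.
Proof.
case: v => [e|f].
  have [f ef] := flat_of e.
  exists [:: mark C (incident ef) false]; split=> //; split=> // p.
  by rewrite inE => /eqP ->; exists (incident ef), false.
have [e [e' [ne ef e'f]]] := flat_two f.
exists [:: mark C (incident ef) true; mark C (incident e'f) true]; split=> //.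
split=> [|p].
  rewrite /= inE andbT; apply: contra ne => /eqP mm; apply/eqP.
  have := @mark_inj _ _ C (incident ef) (incident e'f) true true erefl mm.
  by case.
by rewrite !inE => /orP[/eqP ->|/eqP ->];
  [exists (incident ef), true|exists (incident e'f), true].
Qed.

(** A firing that carries the two points of [E] determines the metric part, and
    the zeros of the curve parts are then chosen at each vertex separately. *)
Lemma refined_rank_ge2 (w : vertex (levi M) -> seq (P1 k)) :
  (forall v, marks_at C v (w v) /\ size (w v) = (2 - size (base_points v))%N) ->
  refined_rank_ge C divisor_at_infinity
    (fun v => pole_space (base_points v ++ w v)) 2.
Proof.
move=> wP E E0 /(effective_deg2 E0)[p [q ->]].
have coeffE x : coeff x (<< p >> + << q >>) = (count_mem x [:: p; q])%:Z.
  by rewrite coeffD !coeffU !mul1r /= addn0 PoszD !natz.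
have [S [Sp Sq Spq]] := carries_two_points (place p) (place q).
have Scap (m : metric_graph R (levi M)) :
    (count_mem m [seq place x | x <- [:: p; q]] <= capacity S m)%N.
  rewrite /= addn0; have [<-|_] := eqVneq (place p) m.
    by rewrite eq_sym; case: eqP => [/Spq|].
  by case: eqP => // <-.
pose T := firing_config S.
have /choice[z zP] v : exists z : seq (P1 k), size z = 2%N /\ forall x,
    ((count_mem x (points_on v [:: p; q]) + count_mem x (w v))%N%:Z <=
     (count_mem x z)%:Z + mark_surplus C T v x).
  have [wv sw] := wP v; have := Scap (inl v); rewrite -size_points_on => sE.
  case: v wv sw sE => [e|f] wv sw sE.
    by have [z] := element_served wv sw sE; exists z.
  by have [z] := flat_served wv sw sE; exists z.
pose y v := base_points v ++ w v.
have szy v : size (z v) = size (y v).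
  by rewrite (zP v).1 size_cat (wP v).2; case: v.
exists (config_ratfun T y z); split=> [v|[i|[v x]]].
- exact: pole_space_vanishing_poly (zP v).1.
- rewrite coeffB coeffE coeff_divisor_at_infinity.
  case: i => eps t; rewrite (@ord_config_interior _ _ T) // count_place_interior.
  by rewrite sub0r addrC subr_ge0 lez_nat; exact: Scap (inr (eps, t)).
- rewrite coeffB coeffE coeff_divisor_at_infinity ord_config_curve //.
  have arith (a b c d : nat) (s : int) : (b + c)%N%:Z <= d%:Z + s ->
    0%:Z <= a%:Z - b%:Z + (d%:Z - (a + c)%N%:Z + s) by lia.
  by have := (zP v).2 x; rewrite count_points_on count_cat; exact: arith.
Qed.

End Final.

Theorem proposition1p4 (R : realType) (k : closedFieldType) (M : matroid)
    (C : metrized_complex k (levi M)) :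
  exists (D : divisor R k (levi M)) (H : vertex (levi M) -> set (ratfun k)),
    lifts_matroid_divisor D /\
    limit_grd C 2 (deg (matroid_divisor M)) D H.
Proof.
have [w wP] := choice (marks_at_exist C).
exists (divisor_at_infinity R k M), (fun v => pole_space (base_points k v ++ w v)).
split; first by exists (fun=> None).
split=> [|y|v|].
- rewrite /divisor_at_infinity /matroid_divisor !raddf_sum; apply: eq_bigr => e _.
  exact: etrans (degU _ _) (esym (degU _ _)).
- exact: (coeff_divisor_at_infinity (inl y : point R k (levi M))).
- exact: pole_space_dim.
split=> [|r]; first exact: refined_rank_ge2.
exact: (@refined_rank_le2 R k (levi M) C _ _ (inr (flat_exists M)) _ r erefl).
Qed.
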